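(* Consider the multi-channel single-hop radio network with random jamming, with error probability $0<p<1$. There exists a transmission array of length $\mathcal O(\log^{-1}(\frac{1}{p})\,n\log n\log^{1/b}k)$ such that the algorithm Wake-Up$(\mathcal T)$ using it wakes up the network within $\mathcal O(\log^{-1}(\frac1p)\,k\log n\log^{1/b}k)$ time steps (counted from the first spontaneous activation), for any number $k\le n$ of spontaneously activated stations, with probability at least $1-1/\mathrm{poly}(n)$.
   Context: Model: $n$ stations with distinct names in $\{1,\dots,n\}$ and $b$ channels numbered $1,\dots,b$; synchronous global time steps; each active station may transmit on any subset of channels per step and all stations listen on all channels. Random jamming: in every time step, every channel is jammed independently with probability $p$ (independently over steps and channels); a jammed channel delivers no message (same feedback as a collision). Otherwise a message on channel $\beta$ in a step is heard by everybody iff exactly one station transmits on $\beta$; there is no collision detection. Initially all stations are passive; at most $k$ stations become active spontaneously at arbitrary time steps $\sigma_u$, and an active station $u$ perceives global step $t$ as its local round $t-\sigma_u$. The network is woken up at the first time step at which some non-jammed channel carries a transmission of exactly one station. A transmission array of length $\ell$ consists of bits $T(u,\beta,j)$ for stations $u$, channels $\beta$, positions $1\le j\le\ell$; in Wake-Up$(\mathcal T)$ each activated station $u$ transmits on channel $\beta$ in its local round $j\le \ell$ iff $T(u,\beta,j)=1$, stopping once a message has been heard. $k$ is unknown to the stations. Logarithms are binary.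
   Formalization: The factor log^{-1}(1/p) is read as max(1, log^{-1}(1/p)), since for p near 0 the stated time falls below one step; log n and log k are taken to be at least 1; as one array serves all k, log^{1/b} k in its length is read as log^{1/b} n. *)

(* Defs.v *)
From mathcomp Require Import all_boot all_order all_algebra.
From mathcomp Require Import reals exp.
Set Implicit Arguments. Unset Strict Implicit. Unset Printing Implicit Defensive.
Import Order.TTheory GRing.Theory Num.Theory.
Local Open Scope ring_scope.

(* Stations are 'I_n (station u stands for the name u+1), channels are 'I_b. *)

(* A transmission array of length l: T u beta j, only positions 1 <= j <= l
   are used. *)
Definition tarray (n b : nat) := 'I_n -> 'I_b -> nat -> bool.

(* Station u (activated spontaneously, u \in S, at global time sigma u)
   transmits on channel beta at global step t in Wake-Up(T) (before the
   network is woken up): its local round j = t - sigma u satisfies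
   1 <= j <= l and T u beta j = 1. *)
Definition transmits n b (T : tarray n b) (l : nat) (S : {set 'I_n})
    (sigma : 'I_n -> nat) (u : 'I_n) (beta : 'I_b) (t : nat) : bool :=
  [&& u \in S, (sigma u < t)%N, (t - sigma u <= l)%N & T u beta (t - sigma u)%N].

(* Given the jamming pattern J on the window of global steps t0, ..., t0 + D
   (J (i, beta) = true iff channel beta is jammed at step t0 + i), the network
   is woken up within D steps from t0 iff at some step of the window some
   non-jammed channel carries the transmission of exactly one station. *)
Definition woken n b (T : tarray n b) l S sigma (t0 D : nat)
    (J : {ffun 'I_D.+1 * 'I_b -> bool}) : bool :=
  [exists i : 'I_D.+1, exists beta : 'I_b,
     ~~ J (i, beta) &&
     (#|[set u | transmits T l S sigma u beta (t0 + i)%N]| == 1)%N].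

Definition jam_weight (R : realType) (p : R) (D b : nat)
    (J : {ffun 'I_D.+1 * 'I_b -> bool}) : R :=
  \prod_(x : 'I_D.+1 * 'I_b) (if J x then p else 1 - p).

Definition wake_prob (R : realType) (p : R) n b (T : tarray n b) l S sigma
    (t0 D : nat) : R :=
  \sum_(J : {ffun 'I_D.+1 * 'I_b -> bool} | woken T l S sigma t0 J)
     jam_weight p J.

(* binary logarithm, and the "log" of the O-bounds, taken to be >= 1 *)
Definition log2b (R : realType) (x : R) : R := ln x / ln 2.
Definition lgb (R : realType) (x : R) : R := log2b (Num.max 2 x).

Definition jfactor (R : realType) (p : R) : R :=
  1 / Num.min 1 (log2b (1 / p)).

(* Main.v *)
(* Take random transmission bits: in local round j, i.e. in block r = j / L with
   L of order log n, channel beta (counted from 0) is used with probability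
   (1/(2(r+1))) (2 y_r)^-(b-1-beta), where y_r = (1 + ln (r+1))^(1/b).  Let Q be
   the least power of two such that the number m of stations awake by step L Q
   satisfies 4 y_Q m <= Q.  By minimality more than Q/(8 y_Q) stations are awake
   throughout the second half of these L Q steps, so there the expected number
   of senders is at least 1/(32 y_Q) on the last channel; on channel 0 it is at
   most 1/4 on average, and it grows by a factor at most 2 y_Q from one channel
   to the next.  Hence in a constant fraction of the steps some channel carries
   a solo transmission with probability of order 1/y_Q.  Distinct steps read
   distinct bits, so E 2^-(number of solo slots) <= exp (- L m / 128), which
   beats the number of activation patterns of m stations: one array produces
   log n solo slots for every pattern.

   The factor log^-1 (1/p) must not enter the union bound, as it is not
   polynomial in n.  Instead each position of the array is repeated g times with
   p^g <= 1/2: the steps of each residue class mod g see an execution of the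
   unstretched array, so all solo slots are jammed with probability at most
   (p^g)^(log n) <= 1/n. *)

Require Import Defs.
From mathcomp Require Import all_boot all_order all_algebra.
From mathcomp Require Import reals sequences exp.
From mathcomp Require Import ring lra zify.
Import Order.TTheory GRing.Theory Num.Theory.
Local Open Scope ring_scope.
Set Implicit Arguments. Unset Strict Implicit. Unset Printing Implicit Defensive.

(** * Expectation over independent bits *)

Section BernoulliExpectation.
Variables (R : realType) (I : finType) (w : I -> R).

Definition bernoulli_weight (f : {ffun I -> bool}) : R :=
  \prod_x (if f x then w x else 1 - w x).

Definition expect (F : {ffun I -> bool} -> R) : R :=
  \sum_f bernoulli_weight f * F f.

Lemma expect_prod_coord (G : I -> bool -> R) :
  expect (fun f => \prod_x G x (f x)) =
  \prod_x (w x * G x true + (1 - w x) * G x false).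
Proof.
rewrite /expect.
under [RHS]eq_bigr => x _ do
  rewrite -(big_bool _ (fun c : bool => (if c then w x else 1 - w x) * G x c)).
by rewrite bigA_distr_bigA; apply: eq_bigr => f _; rewrite -big_split.
Qed.

Lemma expect_cst c : expect (fun=> c) = c.
Proof.
have e1 : expect (fun=> 1) = 1.
  transitivity (expect (fun f => \prod_x (fun _ _ => 1) x (f x))).
    by apply: eq_bigr => f _; rewrite big1.
  by rewrite (expect_prod_coord (fun _ _ => 1)) big1 // => x _; rewrite !mulr1 addrC subrK.
have -> : expect (fun=> c) = expect (fun=> 1) * c.
  by rewrite /expect big_distrl; apply: eq_bigr => f _; rewrite mulr1.
by rewrite e1 mul1r.
Qed.

Lemma eq_expect F G : F =1 G -> expect F = expect G.
Proof. by move=> FG; apply: eq_bigr => f _; rewrite FG. Qed.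

Lemma expect_coord (phi : bool -> R) z :
  expect (fun f => phi (f z)) = w z * phi true + (1 - w z) * phi false.
Proof.
pose G x c := if x == z then phi c else 1.
have -> : expect (fun f => phi (f z)) = expect (fun f => \prod_x G x (f x)).
  apply: eq_expect => f; rewrite (bigD1 z) //= /G eqxx big1 ?mulr1 // => i.
  by move/negPf->.
rewrite expect_prod_coord (bigD1 z) //= /G eqxx big1 ?mulr1 // => i /negPf->.
by rewrite !mulr1 addrC subrK.
Qed.

Lemma expect_sum (K : finType) (P : pred K) (F : K -> {ffun I -> bool} -> R) :
  expect (fun f => \sum_(k | P k) F k f) = \sum_(k | P k) expect (F k).
Proof.
by rewrite exchange_big; apply: eq_bigr => f _; rewrite big_distrr.
Qed.

Lemma expectD F G : expect (fun f => F f + G f) = expect F + expect G.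
Proof. by rewrite -big_split; apply: eq_bigr => f _; rewrite mulrDr. Qed.

Lemma expectZ c F : expect (fun f => c * F f) = c * expect F.
Proof. by rewrite /expect big_distrr; apply: eq_bigr => f _; rewrite mulrCA. Qed.

(* Exchanging the A-coordinates of two independent copies preserves the
   product weight and turns F(f) G(f) into F(f) G(g). *)
Lemma expect_indep2 (A : pred I) F G :
  (forall f g : {ffun I -> bool}, (forall x, A x -> f x = g x) -> F f = F g) ->
  (forall f g : {ffun I -> bool}, (forall x, ~~ A x -> f x = g x) -> G f = G g) ->
  expect (fun f => F f * G f) = expect F * expect G.
Proof.
move=> FA GA.
pose mix (f g : {ffun I -> bool}) := [ffun x => if A x then f x else g x].
rewrite -[LHS]mulr1 -[X in _ * X](expect_cst 1) /expect !big_distrlr !pair_big /=.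
pose sw (q : {ffun I -> bool} * {ffun I -> bool}) := (mix q.1 q.2, mix q.2 q.1).
have swK : involutive sw.
  case=> f g; rewrite /sw /mix /=; congr pair; apply/ffunP => x; rewrite !ffunE;
  by case: (A x).
rewrite [RHS](reindex_inj (inv_inj swK)) /=; apply: eq_bigr => -[f g] _ /=.
have -> : F (mix f g) = F f by apply: FA => x Ax; rewrite ffunE Ax.
have -> : G (mix g f) = G f by apply: GA => x /negPf Ax; rewrite ffunE Ax.
have wE : bernoulli_weight (mix f g) * bernoulli_weight (mix g f) =
          bernoulli_weight f * bernoulli_weight g.
  rewrite -!big_split; apply: eq_bigr => x _ /=; rewrite !ffunE.
  by case: (A x) => //; rewrite mulrC.
by rewrite [RHS]mulrACA wE; ring.
Qed.

(** [kappa] partitions the coordinates into classes and [F k] reads only class [k]; [expect_indep2]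
    splits off one class at a time. *)
Lemma expect_indep (K : eqType) (kappa : I -> K) (s : seq K)
    (F : K -> {ffun I -> bool} -> R) : uniq s ->
  (forall k (f g : {ffun I -> bool}), k \in s ->
     (forall x, kappa x = k -> f x = g x) -> F k f = F k g) ->
  expect (fun f => \prod_(k <- s) F k f) = \prod_(k <- s) expect (F k).
Proof.
elim: s => [|k s IH] /=.
  by move=> _ _; rewrite big_nil -[RHS](expect_cst 1); apply: eq_expect => f; rewrite big_nil.
case/andP=> ks us FK; rewrite big_cons -IH //; last first.
  by move=> k' f g k's; apply: FK; rewrite inE k's orbT.
rewrite -(expect_indep2 (A := fun x => kappa x == k)).
- by apply: eq_expect => f; rewrite big_cons.
- move=> f g fg; apply: FK; rewrite ?mem_head // => x xk; apply: fg.
  exact/eqP.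
- move=> f g fg; apply: eq_big_seq => k' k's; apply: FK.
    by rewrite inE k's orbT.
  by move=> x xk; apply: fg; apply: contraNneq ks => <-; rewrite xk.
Qed.

Hypothesis w01 : forall x, 0 <= w x <= 1.

Lemma bernoulli_weight_ge0 f : 0 <= bernoulli_weight f.
Proof.
apply: prodr_ge0 => x _; have /andP[? ?] := w01 x.
by case: (f x) => //; rewrite subr_ge0.
Qed.

Lemma ler_expect F G : (forall f, F f <= G f) -> expect F <= expect G.
Proof.
by move=> FG; apply: ler_sum => f _; rewrite ler_wpM2l ?bernoulli_weight_ge0.
Qed.

(** First-moment method. The strict inequality in the contradiction needs some [f] of positive
    weight, which exists because the weights sum to 1. *)
Lemma expect_le_exists F c : expect F <= c -> exists f, F f <= c.
Proof.
move=> Fc; have [/existsP//|/existsPn nF] := boolP [exists f, F f <= c].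
have cF f : c < F f by rewrite ltNge.
suff : c < c by rewrite ltxx.
apply: lt_le_trans Fc; rewrite -[ltLHS]expect_cst.
rewrite -subr_gt0 /expect -sumrB.
have: \sum_f bernoulli_weight f = 1.
  rewrite -[RHS](expect_cst 1); by apply: eq_bigr => f _; rewrite mulr1.
move=> s1; rewrite lt_neqAle sumr_ge0 ?andbT; last first.
  by move=> f _; rewrite -mulrBr mulr_ge0 ?bernoulli_weight_ge0 // subr_ge0 ltW.
rewrite eq_sym psumr_neq0; last first.
  by move=> f _; rewrite -mulrBr mulr_ge0 ?bernoulli_weight_ge0 // subr_ge0 ltW.
apply/hasP; suff [f fp] : exists f, 0 < bernoulli_weight f.
  by exists f; rewrite ?mem_index_enum //= -mulrBr mulr_gt0 // subr_gt0.
apply/existsP; apply: contraT => /existsPn n0.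
move: s1; rewrite big1 => [/eqP|f _]; first by rewrite eq_sym oner_eq0.
by apply/eqP; rewrite eq_le bernoulli_weight_ge0 andbT leNgt n0.
Qed.

End BernoulliExpectation.

(** * Transmission rates and their sums *)

Section TransmissionRates.
Variables (R : realType) (b : nat).
Hypothesis b_gt0 : (0 < b)%N.

Definition logroot (r : nat) : R := (1 + ln r.+1%:R) `^ b%:R^-1.

Lemma ln_nat_ge0 (r : nat) : 0 <= ln r.+1%:R :> R.
Proof. by rewrite ln_ge0 // ler1n. Qed.

Lemma le_logroot r s : (r <= s)%N -> logroot r <= logroot s.
Proof.
move=> rs; apply: ge0_ler_powR; rewrite ?invr_ge0 ?nnegrE ?addr_ge0 ?ln_nat_ge0 //.
by rewrite lerD2l ler_ln ?posrE ?ltr0n // ler_nat.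
Qed.

Lemma logroot_ge1 r : 1 <= logroot r.
Proof.
have <- : 1 `^ b%:R^-1 = 1 :> R by rewrite powR1.
apply: ge0_ler_powR; rewrite ?invr_ge0 ?nnegrE ?addr_ge0 ?ln_nat_ge0 //.
by rewrite lerDl ln_nat_ge0.
Qed.

Lemma logrootX r : logroot r ^+ b = 1 + ln r.+1%:R.
Proof.
rewrite -powR_mulrn ?powR_ge0 // -powRrM mulVf ?pnatr_eq0 -?lt0n //.
by rewrite powRr1 // addr_ge0 ?ln_nat_ge0.
Qed.

(* The rate of channel beta is that of the last channel, 1/(2(r+1)), divided by
   2 (1 + ln (r+1))^(1/b) for each channel in between: the factor 2 makes the
   total rate of channel 0 independent of b. *)
Definition rate (beta r : nat) : R :=
  (2 * r.+1%:R * (2 * logroot r) ^+ (b.-1 - beta))^-1.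

Lemma rate_gt0 beta r : 0 < rate beta r.
Proof.
have := logroot_ge1 r => y1.
by rewrite invr_gt0 !mulr_gt0 ?exprn_gt0 ?mulr_gt0 ?ltr0n // (lt_le_trans ltr01).
Qed.

Lemma rate_le1 beta r : rate beta r <= 1.
Proof.
have y1 := logroot_ge1 r; rewrite invf_le1; last first.
  by have := rate_gt0 beta r; rewrite invr_gt0.
have e1 : 1 <= (2 * logroot r) ^+ (b.-1 - beta).
  by apply: exprn_ege1; lra.
have : 1 <= r.+1%:R :> R by rewrite ler1n.
nra.
Qed.

Lemma rate_last r : rate b.-1 r = (2 * r.+1%:R)^-1.
Proof. by rewrite /rate subnn expr0 mulr1. Qed.

Lemma rateS beta r : (beta < b.-1)%N ->
  rate beta.+1 r = 2 * logroot r * rate beta r.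
Proof.
move=> lb; have y1 := logroot_ge1 r; rewrite /rate -(subnSK lb) exprS.
have y0 : logroot r != 0 by rewrite gt_eqF // (lt_le_trans ltr01).
have : (2 * logroot r) ^+ (b.-1 - beta.+1) != 0.
  by rewrite expf_neq0 // mulf_neq0 ?pnatr_eq0.
set e := _ ^+ _ => e0; have r0 : r.+1%:R != 0 :> R by rewrite pnatr_eq0.
by move: r.+1%:R r0 => q q0; field; rewrite ?e0 ?y0 ?q0.
Qed.

(** This is [ln (1 + x) <= x] at [x = - 1 / (r + 2)]. *)
Lemma inv_le_lnB r : r.+2%:R^-1 <= ln r.+2%:R - ln r.+1%:R :> R.
Proof.
have r2 : 0 < r.+2%:R :> R by rewrite ltr0n.
have r1 : 0 < r.+1%:R :> R by rewrite ltr0n.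
have iq : r.+2%:R^-1 < 1 :> R by rewrite invf_lt1 // ltr1n.
have -> : ln r.+1%:R = ln (1 + - r.+2%:R^-1) + ln r.+2%:R :> R.
  rewrite -lnM ?posrE ?subr_gt0 //; congr ln; rewrite mulrDl mulNr mulVf ?gt_eqF // mul1r.
  by rewrite -[r.+2%:R]natr1 addrK.
have := @le_ln1Dx R (- r.+2%:R^-1); rewrite ltrN2 => /(_ iq).
set i := r.+2%:R^-1; set x := ln (1 + - i); set y := ln _; lra.
Qed.

(* [1/(r+1) <= y_r^b - y_(r-1)^b <= b y_r^(b-1) (y_r - y_(r-1))] for
   [y = logroot], so the sum telescopes. *)
Lemma sum_logroot N :
  \sum_(0 <= r < N.+1) (r.+1%:R * logroot r ^+ b.-1)^-1 <= b%:R * logroot N.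
Proof.
elim: N => [|N IH].
  rewrite big_nat1 /logroot ln1 addr0 powR1 expr1n !mulr1 invr1.
  by rewrite ler1n.
rewrite big_nat_recr //=.
have zy := le_logroot (leqnSn N); have z1 := logroot_ge1 N.
have y1 := logroot_ge1 N.+1.
suff : (N.+2%:R * logroot N.+1 ^+ b.-1)^-1 <= b%:R * (logroot N.+1 - logroot N).
  by rewrite mulrBr => /(lerD IH)/le_trans -> //; rewrite addrC subrK.
have : N.+2%:R^-1 <= logroot N.+1 ^+ b - logroot N ^+ b.
  by rewrite !logrootX opprD addrACA subrr add0r inv_le_lnB.
rewrite invfM subrXX.
set y := logroot N.+1 in zy y1 *; set z := logroot N in zy z1 *.
have s_le : \sum_(i < b) y ^+ (b.-1 - i) * z ^+ i <= b%:R * y ^+ b.-1.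
  rewrite mulr_natl -[leRHS](_ : \sum_(i < b) y ^+ b.-1 = _); last first.
    by rewrite sumr_const card_ord.
  apply: ler_sum => i _; have ib : (i <= b.-1)%N by rewrite -ltnS prednK.
  rewrite -[in leRHS](subnK ib) exprD ler_wpM2l ?exprn_ge0 //; first by lra.
  by apply: lerXn2r; rewrite ?nnegrE; lra.
move=> h; rewrite ler_pdivrMr; last by rewrite exprn_gt0 //; lra.
apply: le_trans h _; rewrite [leRHS]mulrAC [leRHS]mulrC.
by apply: ler_wpM2l; lra.
Qed.

(** The factor [b] of [sum_logroot] is absorbed by the powers of 2 in the rates, as
    [b / 2 ^ b <= 1 / 2]. *)
Lemma sum_rate0 N : \sum_(0 <= r < N.+1) rate 0 r <= logroot N / 2.
Proof.
have rE r : rate 0 r = (2 ^+ b)^-1 * (r.+1%:R * logroot r ^+ b.-1)^-1.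
  rewrite /rate subn0 exprMn -invfM -[in RHS](prednK b_gt0) exprS.
  by congr (_^-1); ring.
under eq_bigr => r _ do rewrite rE.
rewrite -big_distrr /=.
apply: (@le_trans _ _ ((2 ^+ b)^-1 * (b%:R * logroot N))).
  by apply: ler_wpM2l; rewrite ?invr_ge0 ?exprn_ge0 ?sum_logroot.
have -> : (2 ^+ b)^-1 * (b%:R * logroot N) = logroot N * (b%:R / 2 ^+ b) by ring.
apply: ler_wpM2l; first by rewrite (le_trans _ (logroot_ge1 N)).
rewrite ler_pdivrMr ?exprn_gt0 // -[in leRHS](prednK b_gt0) exprS mulrA.
rewrite mulVf ?pnatr_eq0 // mul1r -natrX ler_nat.
by case: b b_gt0 => // c _; rewrite ltn_expl.
Qed.

End TransmissionRates.

(** * Solo transmissions in a random array *)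

Section RandomArray.
Variable R : realType.

Lemma prod_1B_ge (K : Type) (s : seq K) (P : pred K) (x : K -> R) :
  (forall k, 0 <= x k <= 1) ->
  1 - \sum_(k <- s | P k) x k <= \prod_(k <- s | P k) (1 - x k).
Proof.
move=> x01; elim: s => [|k s IH]; first by rewrite !big_nil subr0.
rewrite !big_cons; case: ifP => // _; have /andP[x0 x1] := x01 k.
have s0 : 0 <= \sum_(k <- s | P k) x k by apply: sumr_ge0 => i _; case/andP: (x01 i).
apply: (le_trans _ (ler_wpM2l _ IH)); last by rewrite subr_ge0.
by move: s0; set t := \sum_(_ <- _ | _) _; nra.
Qed.

(** A discrete intermediate value argument: just before [psi] first exceeds 1/2 it is already above
    [1 / (4 Y) >= c], since one step multiplies it by at most [2 Y]. *)
Lemma crossing_index (psi : nat -> R) (m : nat) (Y c : R) :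
  0 < Y -> c <= (4 * Y)^-1 ->
  (forall k, (k < m)%N -> psi k.+1 <= 2 * Y * psi k) ->
  psi 0%N <= 1 / 2 -> c <= psi m ->
  exists2 k, (k <= m)%N & c <= psi k <= 1 / 2.
Proof.
move=> Y0 cY psiS psi0 psim.
suff [h|[k /ltnW ? ?]] : psi m <= 1 / 2 \/
    exists2 k, (k < m)%N & c <= psi k <= 1 / 2.
- by exists m; rewrite ?psim.
- by exists k.
have : (m <= m)%N by []; elim: {-2}m => [|k IH] km; first by left.
have [hk|[i ik hi]] := IH (ltnW km); last by right; exists i; rewrite // ltnS ltnW.
have [?|hS] := leP (psi k.+1) (1 / 2); [by left|right; exists k => //].
rewrite hk andbT (le_trans cY) // -div1r ler_pdivrMr; last by rewrite mulr_gt0.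
by have := psiS _ km; nra.
Qed.

Variables (n b L B : nat).
Hypotheses (b_gt0 : (0 < b)%N) (L_gt0 : (0 < L)%N).

Definition slot : finType := ('I_n * 'I_b * 'I_B.+1)%type.

Definition slot_rate (x : slot) : R := rate R b x.1.2 (x.2 %/ L).

Lemma slot_rate01 x : 0 <= slot_rate x <= 1.
Proof. by rewrite /slot_rate ltW ?rate_gt0 ?rate_le1. Qed.

Definition senders (T : tarray n b) (S : {set 'I_n}) (a : 'I_n -> nat)
    (beta : 'I_b) (tau : nat) : {set 'I_n} :=
  [set u in S | (a u < tau)%N && T u beta (tau - a u)%N].

Definition array_of (f : {ffun slot -> bool}) : tarray n b :=
  fun u beta j => f (u, beta, inord j).

(** The set is [setT] because passive stations are encoded by activation times beyond the window. *)
Definition solo f a beta tau := #|senders (array_of f) setT a beta tau| == 1%N.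

(** Expected number of senders on [beta] at step [tau]. *)
Definition load (a : 'I_n -> nat) (beta tau : nat) : R :=
  \sum_(u | (a u < tau)%N) rate R b beta ((tau - a u) %/ L).

Definition awake (a : 'I_n -> nat) (t : nat) := #|[set u | (a u < t)%N]|.

Lemma le_awake a s t : (s <= t)%N -> (awake a s <= awake a t)%N.
Proof.
move=> st; apply: subset_leq_card; apply/subsetP => u.
by rewrite !inE => /leq_trans; apply.
Qed.

Lemma load_ge0 a beta tau : 0 <= load a beta tau.
Proof. by apply: sumr_ge0 => u _; rewrite ltW ?rate_gt0. Qed.

(** The events that [u] is the only sender are disjoint; each has probability [W u] times the
    product of [1 - W v] over the other stations, and that product is at least 1 minus the load. *)
Lemma expect_solo_ge (a : 'I_n -> nat) (beta : 'I_b) tau : (tau <= B)%N ->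
  load a beta tau * (1 - load a beta tau) <=
  expect slot_rate (fun f => (solo f a beta tau)%:R).
Proof.
move=> tB.
pose W u : R := if (a u < tau)%N then rate R b beta ((tau - a u) %/ L) else 0.
have W01 u : 0 <= W u <= 1.
  by rewrite /W; case: ifP; rewrite ?lexx ?ler01 // ltW ?rate_gt0 ?rate_le1.
have loadE : load a beta tau = \sum_u W u by rewrite /load big_mkcond.
pose x (f : {ffun slot -> bool}) u := (a u < tau)%N && array_of f u beta (tau - a u)%N.
pose G u v (f : {ffun slot -> bool}) : R := (x f v == (v == u))%:R.
have EG u v : expect slot_rate (G u v) = if v == u then W v else 1 - W v.
  rewrite /G /x /W; case: ltnP => _ /=; last first.
    by rewrite expect_cst; case: (v == u); rewrite ?subr0.
  have -> := @expect_coord _ _ slot_rate (fun c => (c == (v == u))%:R)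
    (v, beta, inord (tau - a v)).
  rewrite /slot_rate /= inordK ?ltnS ?(leq_trans (leq_subr _ _)) //.
  by case: (v == u); rewrite /= ?mulr0 ?mulr1 ?addr0 ?add0r.
have soloE f : (solo f a beta tau)%:R = \sum_u \prod_v G u v f.
  have GE u : \prod_v G u v f = (senders (array_of f) setT a beta tau == [set u])%:R.
    have [/eqP/setP h|/eqP h] := boolP (_ == [set u]).
      by rewrite big1 // => v _; rewrite /G; have := h v; rewrite !inE /= => <-; rewrite eqxx.
    apply/eqP/prodf_eq0.
    have [v hv] : exists v, x f v != (v == u).
      apply/existsP; apply: contra_notT h => /existsPn h; apply/setP => v.
      by have := h v; rewrite negbK !inE /= => /eqP.
    by exists v => //; rewrite /G (negPf hv).
  under eq_bigr => u _ do rewrite GE.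
  rewrite /solo; have [/cards1P[u ->]|h] := boolP (_ == 1%N).
    rewrite (bigD1 u) //= eqxx big1 ?addr0 // => v vu.
    by rewrite (inj_eq set1_inj) eq_sym (negPf vu).
  rewrite big1 // => u _; case: eqP => // e; by rewrite e cards1 in h.
rewrite (eq_expect _ soloE) expect_sum loadE big_distrl /=.
apply: ler_sum => u _.
rewrite (@expect_indep _ _ _ _ (fun y : slot => y.1.1)) ?index_enum_uniq //; last first.
  by move=> v f g _ fg; rewrite /G /x /array_of fg.
rewrite (eq_bigr _ (fun v _ => EG u v)).
rewrite [leRHS](bigD1 u) //= eqxx; have /andP[W0 _] := W01 u; apply: ler_wpM2l => //.
rewrite [leRHS](eq_bigr (fun v => 1 - W v)) => [|v /negPf-> //].
apply: le_trans (prod_1B_ge _ _ W01).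
by rewrite lerD2l lerN2 [leRHS](bigD1 u) //= lerDr.
Qed.

(** An exponential moment of the number of solo channels: it factorises over independent steps, and
    a small product certifies many solo slots at once. *)
Definition step_miss a tau f : R :=
  \prod_beta (if solo f a beta tau then 1 / 2 else 1).

Lemma expect_step_miss_le1 a tau : expect slot_rate (step_miss a tau) <= 1.
Proof.
rewrite -[leRHS](expect_cst slot_rate); apply: ler_expect; first exact: slot_rate01.
by move=> f; apply: prodr_ile1 => beta _; case: ifP => _; apply/andP; split; lra.
Qed.

Lemma expect_step_miss a (beta : 'I_b) tau : (tau <= B)%N ->
  expect slot_rate (step_miss a tau) <=
  1 - load a beta tau * (1 - load a beta tau) / 2.
Proof.
move=> tB.
apply: (@le_trans _ _ (expect slot_rate
    (fun f => 1 + (- 2^-1) * (solo f a beta tau)%:R))).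
  apply: ler_expect; first exact: slot_rate01.
  move=> f; rewrite /step_miss (bigD1 beta) //=.
  have : \prod_(k | k != beta) (if solo f a k tau then 1 / 2 else 1 : R) <= 1.
    by apply: prodr_ile1 => k _; case: ifP => _; apply/andP; split; lra.
  set y := \prod_(_ | _) _; case: ifP => _ /=; lra.
rewrite expectD expect_cst expectZ; have := expect_solo_ge a beta tB.
by set e := expect _ _; lra.
Qed.

(* If channel 0 has load at most 1/2, then, loads of consecutive channels growing
   by a factor at most 2Y, some channel has load in [1/(32Y), 1/2]; otherwise
   the bound exceeds 1.  Its exponent is affine in the load so that only the
   total load over the window matters in [expect_miss]. *)
Lemma expect_step_miss_exp a tau (Y : R) : (tau <= B)%N -> 1 <= Y ->
  (forall u, (a u < tau)%N -> logroot R b ((tau - a u) %/ L) <= Y) ->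
  (32 * Y)^-1 <= load a b.-1 tau ->
  expect slot_rate (step_miss a tau) <=
  expR (- ((1 - 2 * load a 0 tau) / (128 * Y))).
Proof.
move=> tB Y1 aY hlast; have Y0 : 0 < Y by lra.
have l0 := load_ge0 a 0 tau.
have [h|h] := lerP (load a 0 tau) (1 / 2); last first.
  apply: le_trans (expect_step_miss_le1 _ _) _.
  rewrite -[leLHS]expR0 ler_expR -mulNr mulr_ge0 ?invr_ge0 //; lra.
have [k kb /andP[k1 k2]] : exists2 k, (k <= b.-1)%N &
    (32 * Y)^-1 <= load a k tau <= 1 / 2.
  apply: (@crossing_index _ _ Y) => //.
    by rewrite lef_pV2 ?posrE; lra.
  move=> k kb; rewrite /load mulr_sumr; apply: ler_sum => u au.
  rewrite rateS //; apply: ler_wpM2r; first by rewrite ltW ?rate_gt0.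
  by have := aY _ au; lra.
have kb' : (k < b)%N by rewrite -(prednK b_gt0) ltnS.
apply: le_trans (@expect_step_miss a (Ordinal kb') tau tB) _ => /=.
have e4 : (32 * Y)^-1 / 4 = (128 * Y)^-1 by field; rewrite gt_eqF.
apply: (@le_trans _ _ (1 - (128 * Y)^-1)).
  have lk := load_ge0 a k tau; rewrite -e4; move: k1.
  by set c := (32 * Y)^-1; set l := load a k tau in lk k2 *; nra.
apply: le_trans (expR_ge1Dx _) _; rewrite ler_expR lerN2.
have : 0 <= (128 * Y)^-1 by rewrite invr_ge0; lra.
nra.
Qed.

(** Summing station by station: each awake station passes through the blocks [0] to [N] at most
    once, with at most [L] rounds in each, so [sum_rate0] applies. *)
Lemma sum_load0 (a : 'I_n -> nat) N :
  \sum_(0 <= tau < (L * N).+1) load a 0 tau <=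
  (awake a (L * N))%:R * (L%:R * (logroot R b N / 2)).
Proof.
rewrite /load; under eq_bigr => t _ do rewrite big_mkcond.
rewrite exchange_big /= /awake -sum1_card natr_sum mulr_suml [leRHS]big_mkcond /=.
apply: ler_sum => u _; rewrite inE.
case: ltnP => au; last first.
  rewrite big_nat big1 // => t /andP[_]; rewrite ltnS => tN.
  by rewrite ltnNge (leq_trans tN).
rewrite mul1r.
pose g j := rate R b 0 (j %/ L).
have g0 j : 0 <= g j by rewrite ltW ?rate_gt0.
apply: (@le_trans _ _ (\sum_(0 <= j < N.+1 * L) g j)); last first.
  rewrite big_nat_mul; apply: (@le_trans _ _ (L%:R * \sum_(0 <= r < N.+1) rate R b 0 r)).
    rewrite big_distrr /=; apply: ler_sum => r _.
    rewrite (eq_big_nat _ _ (F2 := fun=> rate R b 0 r)); last first.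
      move=> j /andP[j1 j2]; rewrite /g; congr rate; apply/eqP.
      by rewrite eqn_leq leq_divRL // j1 -ltnS ltn_divLR // j2.
    by rewrite sumr_const_nat mulSn addnK mulr_natl.
  by rewrite ler_wpM2l ?ler0n ?sum_rate0.
rewrite (big_cat_nat (n := a u)) //=; last by rewrite leqW // ltnW.
rewrite big_nat big1 ?add0r => [|t /andP[_ ta]]; last by rewrite ltnNge ltnW.
rewrite -{1}[a u]add0n big_addn [leRHS](big_cat_nat (n := (L * N).+1 - a u)) //=; last first.
  rewrite leq_subLR; apply: (leq_trans _ (leq_addl _ _)).
  by rewrite mulSn mulnC -addn1 addnC leq_add2r.
apply: (@le_trans _ _ (\sum_(0 <= i < (L * N).+1 - a u) g i)); last first.
  by rewrite lerDl sumr_ge0.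
by apply: ler_sum => i _; rewrite addnK; case: ifP.
Qed.

Definition miss a D f : R := \prod_(0 <= tau < D.+1) step_miss a tau f.

Lemma missE a D f :
  miss a D f = 2^-1 ^+ (\sum_(0 <= tau < D.+1) \sum_beta solo f a beta tau).
Proof.
rewrite /miss /step_miss expr_sum; apply: eq_bigr => t _.
rewrite expr_sum; apply: eq_bigr => beta _.
by case: (solo _ _ _ _); rewrite ?expr1 ?expr0 ?div1r.
Qed.

(* Only the steps of the second half of the window, from L 2^q to L 2^(q+1), are
   used: there the last channel has load at least 1/(32Y) and, by [sum_load0],
   the load of channel 0 is at most 1/4 on average. *)
Lemma expect_miss (a : 'I_n -> nat) q (Y := logroot R b (2 ^ q.+1)) :
  (L * 2 ^ q.+1 <= B)%N ->
  4 * Y * (awake a (L * 2 ^ q.+1))%:R <= 2 ^+ q.+1 ->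
  2 ^+ q <= 4 * Y * (awake a (L * 2 ^ q))%:R ->
  expect slot_rate (miss a (L * 2 ^ q.+1)) <=
  expR (- (L%:R * (awake a (L * 2 ^ q.+1))%:R / 128)).
Proof.
move=> LB hM hH; set M := awake a _ in hM *; set D := (L * 2 ^ q.+1)%N in LB *.
have Y1 : 1 <= Y by apply: logroot_ge1.
pose D2 := (L * 2 ^ q)%N.
have DD2 : (D = D2 + D2)%N by rewrite /D /D2 expnS; lia.
have Etau tau : (D2 < tau <= D)%N ->
    expect slot_rate (step_miss a tau) <=
    expR (- ((1 - 2 * load a 0 tau) / (128 * Y))).
  case/andP=> t1 t2; apply: expect_step_miss_exp => //.
  - exact: leq_trans t2 LB.
  - move=> u au; apply: le_logroot; rewrite -(@leq_pmul2r L) //.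
    by apply: leq_trans (leq_trunc_div _ _) _; rewrite mulnC (leq_trans (leq_subr _ _)).
  apply: (@le_trans _ _ ((awake a D2)%:R * (8 * 2 ^+ q)^-1)).
    have q0 : 0 < 2 ^+ q :> R by rewrite exprn_gt0.
    rewrite ler_pdivlMr ?mulr_gt0 // mulrC ler_pdivrMr ?mulr_gt0 //; lra.
  rewrite /awake -sum1_card natr_sum mulr_suml /load.
  rewrite [leLHS](_ : _ = \sum_(u | (a u < D2)%N) (8 * 2 ^+ q)^-1); last first.
    by apply: eq_big => [u|u _]; rewrite ?inE // mul1r.
  rewrite big_mkcond [leRHS]big_mkcond /=; apply: ler_sum => u _.
  case: ltnP => au; last by case: ifP; rewrite // ltW ?rate_gt0.
  rewrite (ltn_trans au t1) rate_last lef_pV2 ?posrE ?mulr_gt0 ?exprn_gt0 ?ltr0n //.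
  have : ((tau - a u) %/ L <= 2 ^ q.+1)%N.
    rewrite -(@leq_pmul2r L) //.
    by apply: leq_trans (leq_trunc_div _ _) _; rewrite mulnC (leq_trans (leq_subr _ _)).
  rewrite expnS -natrX -!natrM ler_nat; have : (0 < 2 ^ q)%N by rewrite expn_gt0.

  by move: (_ %/ _)%N (2 ^ q)%N => x y; lia.
(* Bit [(u, beta, j)] can only be read at step [a u + j], so distinct steps depend on disjoint sets
   of bits. *)
rewrite /miss (@expect_indep _ _ _ _ (fun x : slot => a x.1.1 + x.2)%N) ?iota_uniq //;
  last first.
  move=> tau f g; rewrite mem_index_iota => tD fg; apply: eq_bigr => beta _.
  congr (if _ then _ else _); congr (#|pred_of_set _| == _); apply/setP => u; rewrite !inE /=.
  case: ltnP => //= au; apply: fg => /=; rewrite inordK; first by lia.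
  by rewrite ltnS (leq_trans (leq_subr _ _)) // (leq_trans _ LB) //; lia.
rewrite (big_cat_nat (n := D2.+1)) //=; last by rewrite ltnS DD2 leq_addr.
apply: (@le_trans _ _ (1 * \prod_(D2.+1 <= tau < D.+1)
    expR (- ((1 - 2 * load a 0 tau) / (128 * Y))))).
  have e0 tau : 0 <= expect slot_rate (step_miss a tau).
    rewrite -[leLHS](expect_cst slot_rate); apply: ler_expect; first exact: slot_rate01.
    by move=> f; apply: prodr_ge0 => beta _; case: ifP => _; lra.
  apply: ler_pM; rewrite ?prodr_ge0 //.
    by apply: prodr_ile1 => tau _; rewrite e0 expect_step_miss_le1.
  rewrite big_nat [leRHS]big_nat; apply: ler_prod => tau tD.
  by rewrite e0 Etau.
rewrite mul1r -expR_sum ler_expR sumrN lerN2 -mulr_suml sumrB sumr_const_nat.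
rewrite -mulr_sumr.
have sl : \sum_(D2.+1 <= tau < D.+1) load a 0 tau <= M%:R * (L%:R * (Y / 2)).
  apply: le_trans (sum_load0 a (2 ^ q.+1)).
  rewrite [leRHS](big_cat_nat (n := D2.+1)) //=; last by rewrite ltnS -/D DD2 leq_addr.
  by rewrite lerDr sumr_ge0 // => t _; apply: load_ge0.
move: sl; set s := \sum_(_ <= _ < _) _ => sl.
rewrite subSS DD2 addnK ler_pdivlMr; last by lra.
have -> : 1 *+ D2 = L%:R * 2 ^+ q :> R by rewrite /D2 natrM natrX.
(* By [hM], [2 ^ q >= 2 Y M], so [L 2 ^ q - 2 s >= 2 L Y M - L Y M = L Y M]. *)
move: hM; rewrite exprS => hM.
have L0 : 0 <= L%:R :> R by [].
have := ler_wpM2l L0 hM; set m := M%:R; nra.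
Qed.

End RandomArray.

(** * Window lengths and the union bound over activation patterns *)

Section CoarseArray.
Variable R : realType.

Lemma ln2_gt0 : 0 < ln 2 :> R.
Proof. by rewrite ln_gt0 // ltr1n. Qed.

Lemma ln2_le1 : ln 2 <= 1 :> R.
Proof. by have := @le_ln1Dx R 1; apply; lra. Qed.

Lemma lgb_ge1 (x : R) : 1 <= lgb x.
Proof.
rewrite /lgb /log2b ler_pdivlMr ?ln2_gt0 // mul1r ler_ln ?posrE ?lt_max ?ltr0n //.
by rewrite le_max lexx.
Qed.

Lemma le_lgb (x y : R) : x <= y -> lgb x <= lgb y.
Proof.
move=> xy; rewrite /lgb /log2b ler_pM2r ?invr_gt0 ?ln2_gt0 //.
rewrite ler_ln ?posrE ?lt_max ?ltr0n // ge_max !le_max lexx /=.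
by rewrite xy orbT.
Qed.

Lemma lgb_le_exponent (x : R) m : (0 < m)%N -> x <= 2 ^+ m -> lgb x <= m%:R.
Proof.
move=> m0 xm; rewrite /lgb /log2b ler_pdivrMr ?ln2_gt0 // mulr_natl -lnXn ?ltr0n //.
rewrite ler_ln ?posrE ?lt_max ?ltr0n ?exprn_gt0 ?ltr0n //.
by rewrite ge_max xm andbT -[leLHS]expr1 ler_eXn2l // ltr1n.
Qed.

Lemma exponent_le_lgb (x : R) m : 2 ^+ m <= x -> m%:R <= lgb x.
Proof.
move=> mx; rewrite /lgb /log2b ler_pdivlMr ?ln2_gt0 // mulr_natl -lnXn ?ltr0n //.
rewrite ler_ln ?posrE ?lt_max ?ltr0n ?exprn_gt0 ?ltr0n //.
by rewrite le_max mx orbT.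
Qed.

Lemma ln_nat_le_lgb k : (0 < k)%N -> ln k%:R <= lgb (k%:R : R).
Proof.
move=> k0; apply: (@le_trans _ _ (ln (Num.max 2 k%:R))).
  by rewrite ler_ln ?posrE ?lt_max ?ltr0n // le_max lexx orbT.
rewrite /lgb /log2b ler_pdivlMr ?ln2_gt0 // -[leRHS]mulr1.
by apply: ler_wpM2l; rewrite ?ln2_le1 // ln_ge0 // le_max ler1n.
Qed.

Lemma exists_exp2 (x : R) : 1 <= x -> exists2 q, x <= 2 ^+ q & 2 ^+ q <= 2 * x.
Proof.
move=> x1; have x0 := le_trans ler01 x1.
have N0 : (0 < Num.trunc x)%N by rewrite truncn_gt0.
have := truncn_itv x0; move: (Num.trunc x) N0 => N N0 /andP[N1 N2].
exists (trunc_log 2 N).+1.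
  apply: (le_trans (ltW N2)); rewrite -natrX ler_nat; exact: trunc_log_ltn.
rewrite exprS ler_pM2l ?ltr0n // (le_trans _ N1) // -natrX ler_nat.
exact: trunc_logP.
Qed.

Lemma window_exponent (b k : nat) :
  (0 < b)%N -> (0 < k)%N ->
  exists q, 4 * k%:R * logroot R b (2 ^ q) <= 2 ^+ q <= 128 * k%:R * lgb (k%:R : R) `^ b%:R^-1.
Proof.
move=> b0 k0; have := lgb_ge1 (k%:R : R); have := ln_nat_le_lgb k0.
move: (lgb _) => G lk G1.
have k1 : 1 <= k%:R :> R by rewrite ler1n.
have bi0 : 0 <= b%:R^-1 :> R by rewrite invr_ge0.
have bi1 : b%:R^-1 <= 1 :> R by rewrite invf_le1 ?ltr0n // ler1n.
set g := G `^ _; have g1 : 1 <= g.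
  have <- : 1 `^ b%:R^-1 = 1 :> R by rewrite powR1.
  by apply: ge0_ler_powR; rewrite ?nnegrE //; lra.
have gG : g <= G by apply: ler1_powR.
have kg1 : 1 <= k%:R * g by nra.
(* 64 is 4 times the 16 of the bound [logroot R b (2 ^ q) <= 16 * g] below, which rests on
   [1 + ln (256 k G) <= 9 + 2 G <= 16 G]. *)
have [q q1 q2] : exists2 q, 64 * (k%:R * g) <= 2 ^+ q & 2 ^+ q <= 2 * (64 * (k%:R * g)).
  by apply: exists_exp2; lra.
exists q; apply/andP; split; last by lra.
apply: le_trans q1.
suff : logroot R b (2 ^ q) <= 16 * g by nra.
apply: (@le_trans _ _ ((16 * G) `^ b%:R^-1)); last first.
  by rewrite powRM ?ler0n //; [apply: ler_wpM2r; rewrite ?powR_ge0 // ler1_powR // ler1n|lra].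
apply: ge0_ler_powR; rewrite ?nnegrE ?addr_ge0 ?ln_nat_ge0 //; first by lra.
have kG0 : 0 < k%:R * G by nra.
apply: (@le_trans _ _ (1 + ln (2 ^+ 8 * (k%:R * G)))).
  rewrite lerD2l ler_ln ?posrE ?ltr0n ?mulr_gt0 ?exprn_gt0 ?ltr0n //; try lra.
  rewrite -natr1 natrX; apply: (@le_trans _ _ (2 * (64 * k%:R * G) + k%:R * G)).
    apply: lerD; last by nra.
    by apply: le_trans q2 _; rewrite ler_pM2l ?ltr0n //; nra.
  have -> : 2 ^+ 8 = 256 :> R by rewrite -natrX.
  lra.
rewrite lnM ?posrE ?exprn_gt0 // lnXn ?ltr0n // lnM ?posrE; try lra.
have lG : ln G <= G by rewrite ltW // ln_sublinear //; lra.
have := ln2_le1; rewrite -mulr_natl; lra.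
Qed.

(** The sum factorises over the stations into [(1 + B eta) ^ n <= exp (n B eta) <= exp (1/2)]. The
    weight [eta ^ m] of a pattern with [m] stations offsets the at most [(n B) ^ m] such
    patterns. *)
Lemma sum_support_weights (n B : nat) (eta : R) : 0 <= eta ->
  n%:R * B%:R * eta <= 1 / 2 ->
  \sum_(a : {ffun 'I_n -> 'I_B.+1}) eta ^+ #|[set u | a u != ord_max]| <= 2.
Proof.
move=> e0 h.
have -> : \sum_(a : {ffun 'I_n -> 'I_B.+1}) eta ^+ #|[set u | a u != ord_max]| =
    \sum_(a : {ffun 'I_n -> 'I_B.+1}) \prod_u (if a u != ord_max then eta else 1).
  apply: eq_bigr => a _; rewrite -big_mkcond prodr_const /=.
  by congr (_ ^+ _); apply: eq_card => u; rewrite inE.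
rewrite -(bigA_distr_bigA (fun (u : 'I_n) (v : 'I_B.+1) => if v != ord_max then eta else 1)) /=.
have s v : v = 1 + B%:R * eta ->
    \prod_(u < n) \sum_(i < B.+1) (if i != ord_max then eta else 1) = v ^+ n.
  move=> ->; rewrite prodr_const card_ord; congr (_ ^+ _).
  rewrite (bigD1 ord_max) //= eqxx; congr (_ + _).
  rewrite (eq_bigr (fun=> eta)) => [|i ->] //.
  by rewrite sumr_const cardC1 card_ord mulr_natl.
rewrite (s _ erefl).
apply: (@le_trans _ _ (expR (1 / 2))); last first.
  have h2 := expR_ge1Dx (- (1 / 2) : R).
  have e1 := expRxMexpNx_1 (1 / 2 : R); have := expR_gt0 (1 / 2 : R).
  nra.
apply: (@le_trans _ _ (expR (B%:R * eta) ^+ n)).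
  by apply: lerXn2r; rewrite ?nnegrE ?expR_ge0 ?expR_ge1Dx // addr_ge0 // mulr_ge0.
by rewrite -expRM_natl ler_expR mulrA.
Qed.

Lemma expR_half_le (m : nat) : expR (- m%:R) <= 2^-1 ^+ m :> R.
Proof.
rewrite -[m%:R]mulr1 -mulrN expRM_natl; apply: lerXn2r; rewrite ?nnegrE ?expR_ge0 ?invr_ge0 //.
rewrite expRN lef_pV2 ?posrE ?expR_gt0 //.
by have := expR_ge1Dx (1 : R); lra.
Qed.

Variables (n b : nat).
Hypothesis b_gt0 : (0 < b)%N.

Definition loglen := (trunc_log 2 n).+1.
Local Notation lam := loglen.
(** In [L], 128 cancels the denominator in [expect_miss] and [64 * lam] pays for the union bound.
    Exponents up to [qm] suffice, as [128 k lgb k <= 2 ^ qm] for [k <= n]; [B] is the length of the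
    longest window. *)
Local Notation L := (128 * (64 * lam))%N.
Local Notation qm := (7 + 2 * lam)%N.
Local Notation B := (L * 2 ^ qm)%N.

Lemma ltn_loglen : (n < 2 ^ lam)%N.
Proof. exact: trunc_log_ltn. Qed.

(* The activation patterns fed to the union bound: [ord_max] marks a station
   that is still passive at the end [L * 2 ^ q.+1] of the window. *)
Definition pattern_ok q (a : {ffun 'I_n -> 'I_B.+1}) :=
  [&& 4 * logroot R b (2 ^ q.+1) * (awake (fun u => a u : nat) (L * 2 ^ q.+1))%:R <= 2 ^+ q.+1,
      2 ^+ q <= 4 * logroot R b (2 ^ q.+1) * (awake (fun u => a u : nat) (L * 2 ^ q))%:R &
      [forall u, (a u < L * 2 ^ q.+1)%N || (a u == ord_max)]].

(** Some station is awake, so [64 lam M >= 32 lam + 32 lam M]: the second term weighs the pattern,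
    the first pays for the sum over [q]. *)
Lemma expect_miss_ok q a : (q < qm)%N -> pattern_ok q a ->
  expect (@slot_rate R n b L B) (miss R (fun u => a u : nat) (L * 2 ^ q.+1)) <=
  2^-1 ^+ (32 * lam) * (2^-1 ^+ (32 * lam)) ^+ #|[set u | a u != ord_max]|.
Proof.
move=> qq /and3P[h1 h2 /forallP h3].
have LQB : (L * 2 ^ q.+1 <= B)%N by rewrite leq_pmul2l // leq_exp2l.
have supp : #|[set u | a u != ord_max]| = awake (fun u => a u : nat) (L * 2 ^ q.+1).
  apply: eq_card => u; rewrite !inE; have := h3 u.
  by case: eqP => [->|_] /=; [rewrite ltnNge LQB | rewrite orbF => ->].
have M1 : (0 < awake (fun u => a u : nat) (L * 2 ^ q.+1))%N.
  rewrite lt0n; apply/eqP => M0; move: h2; rewrite leNgt => /negP; apply.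
  have -> : awake (fun u => a u : nat) (L * 2 ^ q) = 0%N.
    apply/eqP; rewrite -leqn0; apply: leq_trans (eq_leq M0).
    by rewrite le_awake // leq_pmul2l // leq_exp2l.
  by rewrite mulr0 exprn_gt0.
apply: le_trans (expect_miss _ _ LQB h1 h2) _ => //.
rewrite supp; move: M1; set M := awake _ _ => M1.
have -> : L%:R * M%:R / 128 = (64 * lam * M)%:R :> R.
  by move: (64 * lam)%N => X; rewrite !natrM; field.
apply: le_trans (expR_half_le _) _.
rewrite -exprM -exprD; apply: ler_wiXn2l; rewrite ?invr_ge0 // ?invf_le1 ?ler1n //.
rewrite -mulnS (_ : 64 = 32 * 2)%N // -!mulnA leq_pmul2l //.
by rewrite mulnCA leq_pmul2l // mulSn mul1n -addn1 leq_add2l.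
Qed.

Lemma exists_good_slots :
  exists f : {ffun slot n b B -> bool}, forall q (a : {ffun 'I_n -> 'I_B.+1}),
    (q < qm)%N -> pattern_ok q a -> miss R (fun u => a u : nat) (L * 2 ^ q.+1) f <= 2^-1 ^+ lam.
Proof.
pose eta : R := 2^-1 ^+ (32 * lam).
have e0 : 0 <= eta by rewrite exprn_ge0 ?invr_ge0.
have l2 : (lam <= 2 ^ lam)%N by apply: ltnW; apply: ltn_expl.
(* [eta] absorbs counts [c] polynomial in [n] and still leaves a factor [2^-1 ^+ m2]. *)
have pow m1 m2 (c : nat) : (c <= 2 ^ m1)%N -> (m1 + m2 <= 32 * lam)%N ->
    c%:R * eta <= 2^-1 ^+ m2.
  move=> cm mm; rewrite /eta; apply: (@le_trans _ _ (2 ^+ m1 * 2^-1 ^+ (32 * lam))).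
    by rewrite ler_wpM2r // -natrX ler_nat.
  rewrite -(subnKC mm) !exprD -mulrA exprVn mulVKf ?expf_neq0 ?pnatr_eq0 //.
  rewrite -[leRHS]mulr1 ler_wpM2l ?exprn_ge0 ?invr_ge0 //.
  by rewrite exprn_ile1 ?invr_ge0 // invf_le1 // ler1n.
pose tot (f : {ffun slot n b B -> bool}) : R :=
  \sum_(q < qm) \sum_(a | pattern_ok q a)
    miss R (fun u => a u : nat) (L * 2 ^ q.+1) f.
have Etot : expect (@slot_rate R n b L B) tot <= 2^-1 ^+ lam.
  rewrite expect_sum.
  apply: (@le_trans _ _ (\sum_(q < qm) (eta * 2))).
    apply: ler_sum => q _; rewrite expect_sum.
    apply: (@le_trans _ _ (\sum_(a : {ffun 'I_n -> 'I_B.+1})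
        eta * eta ^+ #|[set u | a u != ord_max]|)).
      rewrite big_mkcond; apply: ler_sum => a _; case: ifP => ok.
        exact: expect_miss_ok.
      by rewrite mulr_ge0 // exprn_ge0.
    rewrite -mulr_sumr ler_wpM2l //; apply: sum_support_weights => //.
    (* In the bound [n * B <= 2 ^ (20 + 4 * lam)], 20 is 13 from [L] plus 7 from [2 ^ qm]. *)
    rewrite -natrM -[leRHS]expr1 div1r; apply: (@pow (20 + 4 * lam)).
      have := ltnW ltn_loglen => nl.
      have -> : (2 ^ (20 + 4 * lam) = 2 ^ lam * (2 ^ 7 * (2 ^ 6 * 2 ^ lam) * 2 ^ qm))%N.
        by rewrite -!expnD; congr (_ ^ _)%N; lia.
      by rewrite leq_mul // leq_mul // leq_mul // leq_mul.
    rewrite /loglen; lia.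
  rewrite sumr_const card_ord -[leLHS]mulr_natl mulrCA [leLHS]mulrC -natrM.
  apply: (@pow (1 + qm)); last by rewrite /loglen; lia.
  by rewrite expnS mulnC leq_mul // ltnW // ltn_expl.
have [f hf] := expect_le_exists (@slot_rate01 R n b L B) Etot.
exists f => q a qq ok; apply: le_trans hf; rewrite /tot.
have m0 a' D : 0 <= miss R a' D f.
  apply: prodr_ge0 => t _; apply: prodr_ge0 => beta _; case: ifP => _ //.
  by rewrite divr_ge0.
rewrite (bigD1 (Ordinal qq)) //= (bigD1 a) //= -addrA lerDl.
by rewrite addr_ge0 // ?sumr_ge0 // => q' _; rewrite sumr_ge0.
Qed.

Lemma coarse_array : exists T : tarray n b,
  forall (S : {set 'I_n}) (a : 'I_n -> nat), (exists2 u, u \in S & a u = 0%N) ->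
  exists D : nat,
    D%:R <= 2 ^+ 20 * lam%:R * #|S|%:R * lgb (#|S|%:R : R) `^ b%:R^-1 /\
    (lam <= \sum_(0 <= tau < D.+1) \sum_beta (#|senders T S a beta tau| == 1))%N.
Proof.
have [f hf] := exists_good_slots; exists (array_of f) => S a [u0 u0S au0].
have k0 : (0 < #|S|)%N by apply/card_gt0P; exists u0.
pose aw t := #|[set u in S | (a u < t)%N]|.
have [qs /andP[qs1 qs2]] := window_exponent b_gt0 k0.
pose P q := 4 * logroot R b (2 ^ q) * (aw (L * 2 ^ q)%N)%:R <= 2 ^+ q :> R.
have Pqs : P qs.
  apply: le_trans qs1; rewrite mulrAC ler_wpM2r ?powR_ge0 // ler_wpM2l //.
  by rewrite ler_nat; apply: subset_leq_card; apply/subsetP => u; rewrite inE => /andP[].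
(* [P] at the least exponent and its failure just below give the two inequalities of
   [pattern_ok]. *)
have [q Pq qmin] := ex_minnP (ex_intro P qs Pqs).
have qqs := qmin _ Pqs.
have aw1 t : (0 < t)%N -> (0 < aw t)%N.
  by move=> t0; apply/card_gt0P; exists u0; rewrite inE u0S au0.
have {Pqs} : (qs <= qm)%N.
  rewrite -(@leq_exp2l 2) // -(ler_nat R) natrX (le_trans qs2) //.
  have nl := ltn_loglen.
  have kn : (#|S| <= 2 ^ lam)%N.
    by rewrite (leq_trans (max_card _)) // card_ord ltnW.
  have lG : lgb (#|S|%:R : R) `^ b%:R^-1 <= (2 ^ lam)%:R.
    apply: (@le_trans _ _ (lgb (#|S|%:R : R))).
      by apply: ler1_powR; rewrite ?lgb_ge1 // invf_le1 ?ltr0n // ler1n.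
    apply: (@le_trans _ _ lam%:R); last by rewrite ler_nat ltnW // ltn_expl.
    by apply: lgb_le_exponent => //; rewrite -natrX ler_nat.
  have -> : (2 ^ qm)%:R = 128 * (2 ^ lam)%:R * (2 ^ lam)%:R :> R.
    by rewrite -!natrM; congr _%:R; rewrite expnD mul2n -addnn expnD !mulnA.
  apply: ler_pM => //; rewrite ?mulr_ge0 ?powR_ge0 //.
  by rewrite ler_wpM2l // ler_nat.
move/(leq_trans qqs) => qqm.
have LQ q' : (0 < L * 2 ^ q')%N by rewrite muln_gt0 expn_gt0 muln_gt0.
(* Exponent 0 is excluded: [u0] is awake, so the left side of [P 0] is at least 4. *)
case: q Pq qmin qqs qqm => [|q] Pq qmin qqs qqm.
  move: Pq; rewrite /P expr0 leNgt => /negP[].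
  have := logroot_ge1 R b (2 ^ 0); have : 1 <= (aw (L * 2 ^ 0)%N)%:R :> R by rewrite ler1n aw1.
  move: (aw _)%:R (logroot _ _ _) => z y z1 y1; nra.
have nPq : ~~ P q by apply/negP => /qmin; rewrite ltnn.
set D := (L * 2 ^ q.+1)%N in Pq.
have DB : (D <= B)%N by rewrite leq_pmul2l // leq_exp2l.
exists D; split.
  rewrite natrM natrX.
  apply: le_trans (ler_wpM2l (ler0n R L) (le_trans (ler_weXn2l (ler1n R 2) qqs) qs2)) _.
  (* [128 * 64] comes from [L], the last 128 from [window_exponent]. *)
  have -> : 2 ^+ 20 = 128 * 64 * 128 :> R by ring.
  rewrite !natrM; move: (_ `^ _) => g.
  by rewrite le_eqVlt; apply/orP; left; apply/eqP; ring.
(* Stations outside [S] or not awake by [D] get time [ord_max], that is [B >= D], and so send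
   nothing in the window. *)
pose a' : {ffun 'I_n -> 'I_B.+1} :=
  [ffun u => if (u \in S) && (a u < D)%N then inord (a u) else ord_max].
have a'E u t : (t <= D)%N -> (a' u < t)%N = (u \in S) && (a u < t)%N.
  move=> tD; rewrite ffunE; case: (u \in S) => /=; last first.
    by rewrite ltnNge (leq_trans tD DB).
  case: (ltnP (a u) D) => aD /=; last by rewrite !ltnNge (leq_trans tD DB) (leq_trans tD aD).
  by rewrite inordK // ltnS (leq_trans (ltnW aD)).
have awE t : (t <= D)%N -> awake (fun u => a' u : nat) t = aw t.
  by move=> tD; apply: eq_card => u; rewrite !inE a'E.
have D2 : (L * 2 ^ q <= D)%N by rewrite leq_pmul2l // leq_exp2l.
have ok : pattern_ok q a'.
  apply/and3P; split; first by rewrite awE.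
    rewrite awE //; move: nPq; rewrite /P -ltNge => /ltW h; apply: le_trans h _.
    by rewrite ler_wpM2r // ler_wpM2l // le_logroot // leq_exp2l.
  by apply/forallP => u; rewrite a'E // ffunE; case: (_ && _); rewrite //= eqxx.
have := hf q a' qqm ok; rewrite missE.
rewrite ler_iXn2l ?invr_gt0 ?invf_lt1 ?ltr1n //.
congr (_ <= _)%N; apply: eq_big_nat => t /andP[_ tD]; apply: eq_bigr => beta _.
congr (nat_of_bool (_ == _)); apply: eq_card => u.
rewrite !inE a'E //= -andbA; case uS: (u \in S) => //=; case: ltnP => //= aut.
have auD := leq_trans aut tD; rewrite ltnS in tD.
by rewrite ffunE uS auD /= inordK // ltnS (leq_trans (ltnW auD)).
Qed.

End CoarseArray.

(** * Jamming and the stretched array *)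

Section Jamming.
Variable R : realType.

(** The network stays asleep iff every solo slot is jammed, and slots are jammed independently. *)
Lemma wake_probE (p : R) n b (T : tarray n b) l S sigma t0 D :
  wake_prob p T l S sigma t0 D =
  1 - p ^+ (\sum_(0 <= i < D.+1) \sum_(beta < b)
              (#|[set u | transmits T l S sigma u beta (t0 + i)]| == 1)).
Proof.
pose X (x : 'I_D.+1 * 'I_b) :=
  #|[set u | transmits T l S sigma u x.2 (t0 + x.1)]| == 1%N.
have missE (J : {ffun 'I_D.+1 * 'I_b -> bool}) :
    (~~ woken T l S sigma t0 J)%:R = \prod_x (if X x then (J x)%:R else 1) :> R.
  have [/existsP[i /existsP[beta /andP[nJ Xi]]]|nw] /= := boolP (woken T l S sigma t0 J).
    by rewrite (bigD1 (i, beta)) //= /X Xi (negPf nJ) mul0r.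
  rewrite big1 // => -[i beta] _; case: ifP => // Xi.
  move: nw => /existsPn/(_ i)/existsPn/(_ beta).
  by rewrite negb_and negbK -/(X (i, beta)) Xi orbF => ->.
have -> : wake_prob p T l S sigma t0 D =
    1 - expect (fun=> p) (fun J : {ffun 'I_D.+1 * 'I_b -> bool} => (~~ woken T l S sigma t0 J)%:R).
  rewrite -[X in X - _](expect_cst (fun _ : 'I_D.+1 * 'I_b => p)) /expect -sumrB [LHS]big_mkcond.
  apply: eq_bigr => J _; rewrite -mulrBr.
  by case: ifP => _; rewrite /= ?subr0 ?subrr ?mulr1 ?mulr0.
rewrite (eq_expect _ missE).
rewrite (expect_prod_coord _ (fun x c => if X x then c%:R else 1)).
rewrite big_mkord pair_big /= expr_sum; congr (1 - _); apply: eq_bigr => x _.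
rewrite -/(X x); case: (X x); rewrite ?expr0 ?expr1 /= ?mulr1 ?mulr0 ?addr0 //.
by rewrite addrC subrK.
Qed.

(** The floor of [tau + (x - s) / g] is [tau] minus the ceiling of [(s - x) / g]; adding [g - 1] to
    the numerator turns this ceiling into a floor and keeps it a natural number. *)
Lemma coarse_clock (g tau x s : nat) : (x < g)%N -> (s <= tau * g + x)%N ->
  ((tau * g + x - s) %/ g = tau - (s + (g.-1 - x)) %/ g)%N.
Proof.
move=> xg sx; have g0 : (0 < g)%N by apply: leq_ltn_trans xg.
set a := ((s + (g.-1 - x)) %/ g)%N.
have a1 : (a * g <= s + (g.-1 - x))%N by apply: leq_trunc_div.
have a2 : (s + (g.-1 - x) < a.+1 * g)%N by rewrite -ltn_divLR.
have at_ : (a <= tau)%N by rewrite -ltnS ltn_divLR // mulSn; lia.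
move: sx; rewrite -(subnK at_) addnK; move: (tau - a)%N => d sx.
apply/eqP; rewrite eqn_leq leq_divRL // -ltnS ltn_divLR //.
move: a1 a2 sx; rewrite !mulSn mulnDl; move: (a * g)%N (d * g)%N => y z; lia.
Qed.

(** The guard silences the local rounds below [g], which would read position 0, outside the
    array. *)
Definition stretch n b (g : nat) (T : tarray n b) : tarray n b :=
  fun u beta j => (0 < j %/ g)%N && T u beta (j %/ g)%N.

(* At the global steps congruent to x mod g the stretched array behaves like the
   original one, station u being activated at coarse time ceil((s_u - x) / g)
   with s_u = sigma u - t0. *)
Lemma transmits_stretch n b (T : tarray n b) g l (S : {set 'I_n}) sigma t0 tau x beta :
  (x < g)%N -> (tau * g + x <= l)%N -> (forall u, u \in S -> (t0 <= sigma u)%N) ->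
  [set u | transmits (stretch g T) l S sigma u beta (t0 + (tau * g + x))] =
  senders T S (fun u => ((sigma u - t0) + (g.-1 - x)) %/ g)%N beta tau.
Proof.
move=> xg il t0s; have g0 : (0 < g)%N by apply: leq_ltn_trans xg.
apply/setP => u; rewrite !inE /transmits /stretch.
case uS: (u \in S) => //=; have ts := t0s u uS.
have -> : (t0 + (tau * g + x) - sigma u = tau * g + x - (sigma u - t0))%N by lia.
have -> : (sigma u < t0 + (tau * g + x))%N = (sigma u - t0 < tau * g + x)%N by lia.
move: (sigma u - t0)%N => s.
rewrite (leq_trans (leq_subr _ _) il) /=.
case: ltnP => si /=; first by rewrite coarse_clock ?subn_gt0 // ltnW.
apply/esym/negbTE; rewrite negb_and -leqNgt leq_divRL //; apply/orP; left.
lia.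
Qed.

Lemma sum_residues (g D : nat) (F : nat -> nat) :
  (\sum_(0 <= i < D.+1 * g) F i =
   \sum_(0 <= x < g) \sum_(0 <= tau < D.+1) F (tau * g + x))%N.
Proof.
rewrite big_nat_mul exchange_big /=; apply: eq_bigr => tau _.
rewrite -{1}[(tau * g)%N]add0n big_addn mulSn addnK.
by apply: eq_bigr => x _; rewrite addnC.
Qed.

(** [g] is the floor of [1 / log (1/p)] plus 1, so [g log (1/p) >= 1]; the minimum in [jfactor]
    makes it at least 1, which absorbs the rounding. *)
Lemma stretch_factor (p : R) : 0 < p < 1 ->
  exists g : nat, [/\ (0 < g)%N, g%:R <= 2 * jfactor p & p ^+ g <= 2^-1].
Proof.
case/andP=> p0 p1; have l2 := ln2_gt0 R.
have lp : 0 < ln (1 / p) by rewrite ln_gt0 // div1r invf_gt1.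
have lb0 : 0 < log2b (1 / p) by rewrite divr_gt0.
have m0 : 0 < Num.min 1 (log2b (1 / p)) by rewrite lt_min ltr01.
have j1 : 1 <= jfactor p by rewrite /jfactor ler_pdivlMr // [leLHS]mul1r ge_min lexx.
have jl : 1 / log2b (1 / p) <= jfactor p.
  by rewrite /jfactor ler_pM2l // lef_pV2 ?posrE // ge_min lexx orbT.
have l0 : 0 <= 1 / log2b (1 / p) by rewrite divr_ge0 // ltW.
have /andP[t1 t2] := truncn_itv l0; move: t1 t2; set N := Num.trunc _ => t1 t2.
exists N.+1; split => //; first by rewrite -natr1; lra.
rewrite -ler_ln ?posrE ?invr_gt0 ?exprn_gt0 ?ltr0n //.
rewrite lnXn // lnV ?posrE ?ltr0n // -[ln p *+ _]mulr_natl.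
have lpE : ln (1 / p) = - ln p by rewrite div1r lnV.
move: t2; rewrite /log2b lpE in lp *.
rewrite div1r invf_div ltr_pdivrMr // => t2; move: t2 lp.
by move: (N.+1%:R) (ln 2) (ln p) => *; lra.
Qed.

Lemma powR_lgb_ge1 (b : nat) (x : R) : 1 <= lgb x `^ b%:R^-1.
Proof.
rewrite -[leLHS](_ : 1 `^ b%:R^-1 = 1); last by rewrite powR1.
have := lgb_ge1 x; move: (lgb x) => y y1.
by apply: ge0_ler_powR; rewrite ?nnegrE ?invr_ge0 //; lra.
Qed.

(** Ensures that the window for [k] stations fits in an array whose length is the bound for [n]
    stations. *)
Lemma le_step_bound (A G : R) b k m : 0 <= A -> 0 <= G -> (k <= m)%N ->
  A * k%:R * G * lgb (k%:R : R) `^ b%:R^-1 <=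
  A * m%:R * G * lgb (m%:R : R) `^ b%:R^-1.
Proof.
move=> A0 G0 km.
have lk : 0 <= lgb (k%:R : R) by apply: le_trans (lgb_ge1 _).
have lkm : lgb (k%:R : R) <= lgb (m%:R : R) by rewrite le_lgb // ler_nat.
move: (lgb _) (lgb _) lk lkm => x y x0 xy.
apply: (ler_pM _ (powR_ge0 _ _)).
- by apply: mulr_ge0 => //; apply: mulr_ge0.
- by rewrite ler_wpM2r // ler_wpM2l // ler_nat.
- by apply: ge0_ler_powR; rewrite ?nnegrE ?invr_ge0 // (le_trans x0).
Qed.

Lemma loglen_le_lgb n : (0 < n)%N -> (loglen n)%:R <= 2 * lgb (n%:R : R).
Proof.
move=> n0; rewrite /loglen -natr1.
have : (trunc_log 2 n)%:R <= lgb (n%:R : R).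
  by apply: exponent_le_lgb; rewrite -natrX ler_nat trunc_logP.
by have := lgb_ge1 (n%:R : R); move: (lgb _) (trunc_log 2 n)%:R => y x; lra.
Qed.

End Jamming.

Theorem theorem4 (R : realType) :
  exists c : R, 0 < c /\ exists C : R, 0 < C /\
  forall (n b : nat) (p : R), (0 < n)%N -> (0 < b)%N -> 0 < p < 1 ->
  exists (l : nat) (T : tarray n b),
    l%:R <= C * jfactor p * n%:R * lgb (n%:R : R)
              * lgb (n%:R : R) `^ (b%:R^-1) /\
    forall (S : {set 'I_n}) (sigma : 'I_n -> nat) (t0 : nat),
      (exists2 u, u \in S & sigma u = t0) ->
      (forall u, u \in S -> (t0 <= sigma u)%N) ->
      exists D : nat,
        D%:R <= C * jfactor p * #|S|%:R * lgb (n%:R : R)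
                  * lgb (#|S|%:R : R) `^ (b%:R^-1) /\
        wake_prob p T l S sigma t0 D >= 1 - (n%:R `^ c)^-1.
Proof.
(* [2 ^ 23] is the [2 ^ 20] of [coarse_array] times 8: a factor 2 each for [loglen n <= 2 * lgb n],
   [D0 + 1 <= 2 * cbnd] and [g <= 2 * jfactor p]. *)
exists 1; split => //; exists (2 ^+ 23); split; first exact: exprn_gt0.
move=> n b p n0 b0 p01; have /andP[p_gt0 p_lt1] := p01.
have [g [g0 gj pg]] := stretch_factor p01.
have [T hT] := coarse_array R n b0.
have : 0 <= jfactor p by have : 0 <= g%:R :> R := ler0n _ _; lra.
move: (jfactor p) gj => j gj j0.
pose C : R := 2 ^+ 23; have C0 : 0 <= C by apply: exprn_ge0.
have CE : C = 8 * 2 ^+ 20 by rewrite /C; ring.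
rewrite -/C; move: C C0 CE => C C0 CE.
have A0 : 0 <= C * j by apply: mulr_ge0.
have G0 : 0 <= lgb (n%:R : R) by apply: le_trans (lgb_ge1 _).
pose bnd k : R := C * j * k%:R * lgb (n%:R : R) * lgb (k%:R : R) `^ b%:R^-1.
have bnd_ge0 k : 0 <= bnd k.
  by apply: mulr_ge0 (powR_ge0 _ _); apply: mulr_ge0 => //; apply: mulr_ge0.
exists (Num.trunc (bnd n)), (stretch g T); split; first by rewrite truncn_le.
move=> S sigma t0 [u0 u0S su0] t0s.
have k0 : (0 < #|S|)%N by apply/card_gt0P; exists u0.
pose cbnd : R := 2 ^+ 20 * (loglen n)%:R * #|S|%:R * lgb (#|S|%:R : R) `^ b%:R^-1.
have c1 : 1 <= cbnd.
  apply: mulr_ege1 (powR_lgb_ge1 _ _); apply: mulr_ege1; rewrite ?ler1n //.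
  by apply: mulr_ege1; rewrite ?ler1n // exprn_ege1 // ler1n.
have c0 := le_trans ler01 c1.
(* One coarse window for all residues: the [D'] given by [coarse_array] depends on the residue but
   never exceeds [D0]. *)
pose D0 := Num.trunc cbnd.
have Dlt : (0 < D0.+1 * g)%N by rewrite muln_gt0.
(* Steps [0] to [D] are exactly [D0.+1] full periods of length [g]. *)
pose D := (D0.+1 * g).-1.
have DS : D.+1 = (D0.+1 * g)%N by rewrite prednK.
have Dbnd : D%:R <= bnd #|S|.
  have : D%:R <= D0.+1%:R * g%:R :> R by rewrite -natrM ler_nat leq_pred.
  move/le_trans; apply.
  apply: (@le_trans _ _ ((2 * cbnd) * (2 * j))).
    apply: ler_pM => //; rewrite -natr1.
    by have : D0%:R <= cbnd; [rewrite truncn_le|lra].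
  have := loglen_le_lgb R n0; have := powR_lgb_ge1 b (#|S|%:R : R).
  rewrite /bnd /cbnd CE; set y := lgb _ `^ _; set G := lgb n%:R.
  move: y G (loglen n)%:R => y G lam y1 lamG.
  have : 0 <= 2 ^+ 20 * #|S|%:R * y * j * 4.
    by rewrite !mulr_ge0 ?exprn_ge0 //; lra.
  by move/ler_wpM2l/(_ _ _ lamG); move: (2 ^+ 20) => z; lra.
exists D; split => //.
have Dl : (D <= Num.trunc (bnd n))%N.
  rewrite (truncn_ge_nat _ (bnd_ge0 n)).
  apply: le_trans Dbnd (le_step_bound _ A0 G0 _).
  by rewrite -[n in (_ <= n)%N]card_ord max_card.
rewrite wake_probE DS sum_residues powRr1 ?ler0n // lerD2l lerN2.
set N := (\sum_(_ <= _ < _) _)%N.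
have gN : (g * loglen n <= N)%N.
  rewrite -[g in (g * _)%N]subn0 -sum_nat_const_nat; rewrite big_nat /N [leqRHS]big_nat.
  apply: leq_sum => x /andP[_ xg].
  pose a u := ((sigma u - t0 + (g.-1 - x)) %/ g)%N.
  have [|D' [D'b hD']] := hT S a.
    (* [u0] starts at coarse time 0 for every residue, as [g - 1 - x < g]. *)
    exists u0; first exact: u0S.
    by rewrite /a su0 subnn add0n divn_small // (leq_ltn_trans (leq_subr _ _)) ?prednK.
  have D'0 : (D' <= D0)%N by rewrite truncn_ge_nat.
  apply: leq_trans hD' _.
  rewrite [leqRHS](big_cat_nat (n := D'.+1)) //=; apply: leq_trans (leq_addr _ _).
  apply: eq_leq; apply: eq_big_nat => tau /andP[_ tD]; apply: eq_bigr => beta _.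
  have il : (tau * g + x <= Num.trunc (bnd n))%N.
    apply: leq_trans Dl; rewrite -ltnS DS.
    apply: (@leq_trans (tau.+1 * g)); first by rewrite mulSn addnC ltn_add2r.
    by rewrite leq_mul2r (leq_trans tD) ?orbT.
  by rewrite (transmits_stretch _ _ xg il t0s).
apply: (@le_trans _ _ (p ^+ (g * loglen n))).
  by apply: ler_wiXn2l; rewrite // ltW.
rewrite exprM; apply: (@le_trans _ _ (2^-1 ^+ loglen n)).
  by apply: lerXn2r; rewrite ?nnegrE ?exprn_ge0 ?invr_ge0 // ltW.
rewrite exprVn lef_pV2 ?posrE ?exprn_gt0 ?ltr0n //.
by rewrite -natrX ler_nat ltnW // ltn_loglen.
Qed.
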